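(* Let $F,R,Q,\mathcal E$ satisfy Conditions 1–4 of the context. Let $u=u(t,x)\in\omega$ and $U_1=U_1(t,x),\,U_2=U_2(t,x)\in\mathbb R^N$ be smooth, and consider the Chapman–Enskog expansion $$U^\varepsilon=\mathcal E(u)+\varepsilon U_1+\varepsilon^2U_2+\cdots,\qquad QU^\varepsilon=u ,$$ of a solution of $\varepsilon\,\partial_tU^\varepsilon+\partial_xF(U^\varepsilon)=-R(U^\varepsilon)/\varepsilon$, i.e. the equation is required to hold at the orders $\varepsilon^0$ and $\varepsilon^1$ as $\varepsilon\to0$, and $QU_1=QU_2=0$. Then $u$ satisfies the effective system $$\partial_tu=-\partial_x\Big(Q\,A(\mathcal E(u))\,U_1\Big)=\partial_x\big(\mathcal M(u)\,\partial_xu\big)$$ for some $n\times n$ matrix $\mathcal M(u)$ (depending only on the value $u\in\omega$), where $U_1$ is the unique solution of $$B(\mathcal E(u))\,U_1=-A(\mathcal E(u))\,\partial_x\big(\mathcal E(u)\big),\qquad QU_1=0 .$$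
   Context: Let $\Omega\subset\mathbb R^N$ be open and convex, and $F,R:\Omega\to\mathbb R^N$ smooth. Consider the system $\varepsilon\,\partial_tU+\partial_xF(U)=-R(U)/\varepsilon$ with $U=U(t,x)\in\Omega$, $t>0$, $x\in\mathbb R$, $\varepsilon>0$. Put $A(U)=D_UF(U)$, $B(U)=D_UR(U)$. The system is hyperbolic: $A(U)$ has real eigenvalues and a full basis of eigenvectors for each $U\in\Omega$. Condition 1: there is a constant $n\times N$ matrix $Q$ of rank $n<N$ with $QR(U)=0$ for all $U\in\Omega$. Put $\omega=Q\Omega\subset\mathbb R^n$. Condition 2: there is a smooth map $\mathcal E:\omega\to\Omega$ with $R(\mathcal E(u))=0$ and $Q\mathcal E(u)=u$ for all $u\in\omega$. Condition 3: $QF(\mathcal E(u))=0$ for all $u\in\omega$. Condition 4: for all $u\in\omega$, $\dim\ker B(\mathcal E(u))=n$ and $\ker B(\mathcal E(u))\cap\operatorname{Im}B(\mathcal E(u))=\{0\}$. *)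

(* Defs.v *)
(* MathComp-Analysis; the real line is an arbitrary [K : realType], R^m is the
   space ['cV[K]_m] of column vectors, and (t, x) is a point of [K * K]. *)
From HB Require Import structures.
From mathcomp Require Import all_boot all_order all_algebra.
From mathcomp Require Import all_classical all_reals all_analysis.

Set Implicit Arguments.
Unset Strict Implicit.
Unset Printing Implicit Defensive.

Import Order.TTheory GRing.Theory Num.Theory.
Import numFieldNormedType.Exports.
Local Open Scope classical_set_scope.
Local Open Scope ring_scope.

(* [Ck_on k D f]: f is of class C^k on D.  Meant for D open: differentiability
   and continuity at the points of D are taken in the ambient space, and the
   values of f outside D are irrelevant. *)
Fixpoint Ck_on (K : realType) (V W : normedModType K) (k : nat)
    (D : set V) (f : V -> W) : Prop :=
  match k with
  | 0 => forall x, D x -> {for x, continuous f}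
  | k'.+1 => (forall x, D x -> differentiable f x) /\
             (forall v : V, Ck_on k' D (fun x => 'D_v f x))
  end.

Definition smooth_on (K : realType) (V W : normedModType K)
    (D : set V) (f : V -> W) : Prop :=
  forall k, Ck_on k D f.

(* The library's ['J f p] acts on row vectors and is the transpose of this. *)
Definition jac (K : realType) (m n : nat) (f : 'cV[K]_m -> 'cV[K]_n)
    (U : 'cV[K]_m) : 'M[K]_(n, m) :=
  \matrix_(i < n, j < m) ('D_(delta_mx j 0) f U) i 0.

Definition half_plane (K : realType) : set (K * K) := [set p | 0 < p.1].

Definition dt (K : realType) (W : normedModType K) (f : K * K -> W)
    (p : K * K) : W := 'D_((1, 0) : K * K) f p.

Definition dx (K : realType) (W : normedModType K) (f : K * K -> W)
    (p : K * K) : W := 'D_((0, 1) : K * K) f p.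

(* The columns of P are a basis of eigenvectors of A, with the real entries of
   d as eigenvalues. *)
Definition real_eigenbasis (K : realType) (N : nat) (A : 'M[K]_N) : Prop :=
  exists (P : 'M[K]_N) (d : 'rV[K]_N),
    P \in unitmx /\ A *m P = P *m diag_mx d.

Definition range_of (K : realType) (N n : nat) (Q : 'M[K]_(n, N))
    (Omega : set 'cV[K]_N) : set 'cV[K]_n :=
  [set Q *m V | V in Omega].

(* [kermx] and the inclusion of subspaces refer to row spaces: the rows of
   [kermx B^T] span (the transpose of) the space of the columns V such that
   B *m V = 0, and the rows of B^T span that of the image of B. *)
Definition ker_dim (K : realType) (N : nat) (B : 'M[K]_N) : nat :=
  \rank (kermx B^T).

Definition ker_im_trivial (K : realType) (N : nat) (B : 'M[K]_N) : Prop :=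
  (kermx B^T :&: B^T)%MS = 0.

(* f^e = f0 + e f1 + e^2 f2 + o(e^2) as e -> 0+ *)
Definition expands (K : realType) (W : normedModType K) (f : K -> W)
    (f0 f1 f2 : W) : Prop :=
  (e ^- 2 *: (f e - (f0 + e *: f1 + e ^+ 2 *: f2))) @[e --> 0^'+] --> (0 : W).

Definition residual (K : realType) (N : nat) (F R : 'cV[K]_N -> 'cV[K]_N)
    (e : K) (U : K * K -> 'cV[K]_N) (p : K * K) : 'cV[K]_N :=
  e *: dt U p + dx (F \o U) p + e^-1 *: R (U p).

(* U^e = U0 + e U1 + e^2 U2 + ..., Q U^e = u, satisfies the relaxation system
   e dt U + dx F(U) = - R(U) / e at the orders e^0 and e^1: the residual is o(e).
   The dots stand for any remainder which is o(e^2), together with its first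
   derivatives, pointwise in (t, x); this covers the truncated expansion and
   finite sums of smooth terms e^k U_k, k >= 3.  If U0 takes its values in the
   open domain of F and R, then at a fixed (t, x) so does U^e for small e > 0;
   the term of order e^-1 of the residual is then R(U0) / e. *)
Record chapman_enskog (K : realType) (N n : nat)
    (F R : 'cV[K]_N -> 'cV[K]_N) (Q : 'M[K]_(n, N)) (u : K * K -> 'cV[K]_n)
    (U0 U1 U2 : K * K -> 'cV[K]_N) (U : K -> K * K -> 'cV[K]_N) : Prop :=
  ChapmanEnskog {
    ce_smooth : \forall e \near 0^'+, smooth_on (@half_plane K) (U e);
    ce_expands : forall p, half_plane p ->
      expands (fun e => U e p) (U0 p) (U1 p) (U2 p);
    ce_expands_dt : forall p, half_plane p ->
      expands (fun e => dt (U e) p) (dt U0 p) (dt U1 p) (dt U2 p);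
    ce_expands_dx : forall p, half_plane p ->
      expands (fun e => dx (U e) p) (dx U0 p) (dx U1 p) (dx U2 p);
    ce_proj : \forall e \near 0^'+, forall p, half_plane p -> Q *m U e p = u p;
    ce_proj1 : forall p, half_plane p -> Q *m U1 p = 0;
    ce_proj2 : forall p, half_plane p -> Q *m U2 p = 0;
    ce_residual : forall p, half_plane p ->
      (e^-1 *: residual F R e (U e) p) @[e --> 0^'+] --> (0 : 'cV[K]_N)
  }.

(* Main.v *)
(* Multiply the equation by Q: since QR = 0 the stiff source disappears, and since
   QF(E(u)) = 0 the flux term of order 0 does too, so the order e^1 gives
   dt u + Q (F''(E(u))[U1, dx E(u)] + A(E(u)) dx U1) = 0.  By the symmetry of F''
   the bracket is dx (A(E(u)) U1).  The order e^0 is B(E(u)) U1 = - A(E(u)) dx E(u).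
   As BE' = 0, QE' = 1 and dim ker B = n, the kernel of B is the image of E', on
   which Q is injective; so the matrix with the rows of B and Q has a left inverse,
   which expresses U1 linearly in dx u with coefficients depending only on u. *)
Require Import Defs.
From HB Require Import structures.
From mathcomp Require Import all_boot all_order all_algebra.
From mathcomp Require Import all_classical all_reals all_analysis.

Set Implicit Arguments.
Unset Strict Implicit.
Unset Printing Implicit Defensive.

Import Order.TTheory GRing.Theory Num.Theory.
Import numFieldNormedType.Exports.
Local Open Scope classical_set_scope.
Local Open Scope ring_scope.

(** * Directional derivatives and Jacobians on column vectors *)

Lemma cV_expand (K : realType) (m : nat) (x : 'cV[K]_m) :
  x = \sum_j x j 0 *: delta_mx j 0.
Proof.
apply/colP => i; rewrite summxE (bigD1 i)//= !mxE !eqxx mulr1 big1 ?addr0//.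
by move=> j ji; rewrite !mxE eq_sym (negbTE ji) mulr0.
Qed.

(** In finite dimension a linear map is a finite sum of coordinates times fixed vectors. *)
Lemma linear_cV_continuous (K : realType) (m : nat) (W : normedModType K)
    (f : {linear 'cV[K]_m -> W}) : continuous f.
Proof.
move=> x; apply: differentiable_continuous.
have -> : (f : _ -> _) = \sum_j (fun y : 'cV[K]_m => y j 0 *: f (delta_mx j 0)).
  apply/funext => y; rewrite [in LHS](cV_expand y) linear_sum fct_sumE.
  by apply: eq_bigr => j _; rewrite linearZ.
by apply: differentiable_sum => j; apply: differentiableZl; apply: differentiable_coord.
Qed.

Lemma derive_comp (K : realType) (V W X : normedModType K) (f : V -> W)
    (g : W -> X) (x v : V) : differentiable f x -> differentiable g (f x) ->
  'D_v (g \o f) x = 'D_('D_v f x) g (f x).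
Proof.
move=> df dg; rewrite !deriveE//; last exact: differentiable_comp.
by rewrite diff_comp.
Qed.

Lemma mulmx_differentiable (K : realType) (m n : nat) (A : 'M[K]_(n, m)) x :
  differentiable (mulmx A : 'cV[K]_m -> 'cV[K]_n) x.
Proof. exact/linear_differentiable/linear_cV_continuous. Qed.

Lemma derive_mulmx (K : realType) (V : normedModType K) (m n : nat)
    (A : 'M[K]_(n, m)) (f : V -> 'cV[K]_m) (x v : V) : differentiable f x ->
  'D_v (fun y => A *m f y) x = A *m 'D_v f x.
Proof.
move=> df; rewrite (derive_comp v df (mulmx_differentiable A _)).
rewrite deriveE; last exact: mulmx_differentiable.
by rewrite diff_lin//; exact: linear_cV_continuous.
Qed.

Lemma jac_mulE (K : realType) (m n : nat) (f : 'cV[K]_m -> 'cV[K]_n) x v :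
  jac f x *m v = \sum_j v j 0 *: 'D_(delta_mx j 0) f x.
Proof.
apply/colP => i; rewrite mxE summxE; apply: eq_bigr => j _.
by rewrite !mxE mulrC.
Qed.

Lemma derive_jac (K : realType) (m n : nat) (f : 'cV[K]_m -> 'cV[K]_n) x v :
  differentiable f x -> 'D_v f x = jac f x *m v.
Proof.
move=> df; rewrite jac_mulE deriveE// [in LHS](cV_expand v) linear_sum.
by apply: eq_bigr => j _; rewrite linearZ deriveE.
Qed.

Lemma derive_comp_jac (K : realType) (V : normedModType K) (m n : nat)
    (f : V -> 'cV[K]_m) (g : 'cV[K]_m -> 'cV[K]_n) (x v : V) :
  differentiable f x -> differentiable g (f x) ->
  'D_v (g \o f) x = jac g (f x) *m 'D_v f x.
Proof. by move=> df dg; rewrite derive_comp// derive_jac. Qed.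

(** * Difference quotients along one-sided curves *)

Lemma cvg_of_quotient (K : realType) (V : normedModType K) (a : K -> V) (x v : V) :
  e^-1 *: (a e - x) @[e --> 0^'+] --> v -> a e @[e --> 0^'+] --> x.
Proof.
move=> av.
have e0 : e @[e --> (0 : K)^'+] --> (0 : K) by apply: cvg_within.
have h : e *: (e^-1 *: (a e - x)) + x @[e --> 0^'+] --> x.
  by rewrite -[X in _ --> X]add0r -(scale0r v); apply: cvgD (cvgZ e0 av) (cvg_cst x).
apply: (cvg_trans _ h); apply: near_eq_cvg; near=> e.
rewrite scalerA divff ?scale1r ?subrK//.
Unshelve. all: by end_near. Qed.

(** A chain rule for a curve [a] constrained only as [e] tends to 0 from the right, with no value at
    0. The remainder of [f] is o(|a e - x|), and |a e - x| is [e] times a convergent quotient, so it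
    is O(e). *)
Lemma cvg_diff_quotient (K : realType) (V W : normedModType K) (f : V -> W)
    (a : K -> V) (x v : V) : differentiable f x ->
  e^-1 *: (a e - x) @[e --> 0^'+] --> v ->
  e^-1 *: (f (a e) - f x) @[e --> 0^'+] --> 'D_v f x.
Proof.
move=> df av; rewrite deriveE//.
have b0 : a e - x @[e --> 0^'+] --> 0.
  by rewrite -(subrr x); apply: cvgB (cvg_of_quotient av) (cvg_cst x).
have lin : 'd f x (e^-1 *: (a e - x)) @[e --> 0^'+] --> 'd f x v.
  apply: (@cvg_comp _ _ _ _ ('d f x) _ _ _ av).
  exact: (diff_continuous df).
rewrite -(addr0 ('d f x v)).
have -> : (fun e => e^-1 *: (f (a e) - f x)) =
   (fun e => 'd f x (e^-1 *: (a e - x)) +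
      e^-1 *: (f (a e) - f x - 'd f x (a e - x))).
  by apply/funext => e; rewrite linearZ/= -scalerDr addrCA subrr addr0.
apply: cvgD => //.
apply/cvgr0Pnorm_lt => eps eps0.
(* The quotient of [a] tends to [v], so its norm is eventually below [|v| + 1]; hence the tolerance
   [eps / (|v| + 1)] for the remainder. *)
have M0 : 0 < `|v| + 1 by rewrite ltr_wpDl.
have [_ /eqaddoP /(_ (eps / (`|v| + 1)))] := (diff_locallyP _ _).1 df.
rewrite divr_gt0// => /(_ isT) small.
have smallb : \forall e \near (0 : K)^'+,
    `|f (a e) - f x - 'd f x (a e - x)| <= eps / (`|v| + 1) * `|a e - x|.
  apply: (@filterS _ (0 : K)^'+ _ _ _ _ (b0 _ small)) => e /=.
  rewrite -[(_ - _) (a e - x)]/(f (a e - x + x) - (f x + 'd f x (a e - x))).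
  by rewrite subrK opprD addrA.
near=> e.
have e0 : 0 < e by near: e; exact: nbhs_right_gt.
rewrite normrZ normfV (gtr0_norm e0) mulrC ltr_pdivrMr//.
apply: (@le_lt_trans _ _ (eps / (`|v| + 1) * `|a e - x|)).
  by near: e; exact: smallb.
have -> : `|a e - x| = e * `|e^-1 *: (a e - x)|.
  by rewrite normrZ normfV gtr0_norm// mulVKf ?gt_eqF.
rewrite mulrCA [eps * e]mulrC ltr_pM2l// -mulrA gtr_pMr// mulrC ltr_pdivrMr// mul1r.
rewrite (@le_lt_trans _ _ (`|v| + `|v - e^-1 *: (a e - x)|))//.
  by rewrite -[X in `|X| <= _](subKr v) ler_normB.
by rewrite ltrD2l; near: e; exact: ((cvgrPdist_lt _ _).1 av _ ltr01).
Unshelve. all: by end_near. Qed.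

(** * Symmetry of second derivatives *)

(** Keeps the intermediate points of the mean value theorem inside a given neighbourhood; it is
    continuity of (s, t) |-> x + s a + t b at the origin. *)
Lemma near_plane (K : realType) (V : normedModType K) (a b x : V) (P : set V) :
  nbhs x P -> exists2 r : K, 0 < r &
    forall s t : K, `|s| < r -> `|t| < r -> P (x + s *: a + t *: b).
Proof.
move=> xP.
have c : (fun q : K * K => x + q.1 *: a + q.2 *: b) @ nbhs (0, 0) -->
    x + 0 *: a + 0 *: b.
  apply: cvgD; first apply: cvgD; first exact: cvg_cst.
  - by apply: cvgZ; [exact: (@cvg_fst _ _ (nbhs (0 : K)) (nbhs (0 : K)))|exact: cvg_cst].
  - by apply: cvgZ; [exact: (@cvg_snd _ _ (nbhs (0 : K)) (nbhs (0 : K)))|exact: cvg_cst].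
rewrite !scale0r !addr0 in c.
have /nbhs_ballP[r /= r0 rP] := c _ xP.
exists r => // s t sr tr; apply: (rP (s, t)).
by split; rewrite /= -ball_normE /ball_ /= sub0r normrN.
Qed.

Lemma is_derive_line (K : realType) (V W : normedModType K) (g : V -> W)
    (y a : V) (t : K) : derivable g (y + t *: a) a ->
  is_derive t 1 (fun s => g (y + s *: a)) ('D_a g (y + t *: a)).
Proof.
rewrite /derivable => dg.
have E : (fun h : K => h^-1 *: (((fun s => g (y + s *: a)) \o shift t) (h *: 1)
     - g (y + t *: a))) =
  (fun h => h^-1 *: ((g \o shift (y + t *: a)) (h *: a) - g (y + t *: a))).
  apply/funext => h /=; congr (_ *: (g _ - _)).
  by rewrite [h *: 1]mulr1 scalerDl addrCA.
by split; rewrite /derivable /derive E.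
Qed.

(** Two uses of the mean value theorem, along [a] and then along [b], make the quotient equal to the
    mixed derivative at a point of the small parallelogram; continuity at [x] concludes. *)
Lemma second_difference_cvg (K : realType) (V : normedModType K) (g : V -> K)
    (D : set V) (a b x : V) : open D -> D x ->
  (forall y, D y -> derivable g y a) ->
  (forall y, D y -> derivable ('D_a g) y b) ->
  {for x, continuous ('D_b ('D_a g))} ->
  s ^- 2 * (g (x + s *: a + s *: b) - g (x + s *: a) - g (x + s *: b) + g x)
    @[s --> 0^'+] --> 'D_b ('D_a g) x.
Proof.
move=> oD Dx dg ddg hc; apply/cvgrPdist_lt => eps eps0.
have [|r r0 rP] := @near_plane _ _ a b x
  (D `&` [set y | `|'D_b ('D_a g) x - 'D_b ('D_a g) y| < eps]).
  by apply: filterI; [exact: open_nbhs_nbhs|exact: ((cvgrPdist_lt _ _).1 hc)].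
near=> s.
have s0 : 0 < s by near: s; exact: nbhs_right_gt.
have sr : s < r by near: s; exact: nbhs_right_lt.
have in0s t : t \in `[0, s] -> `|t| < r.
  rewrite in_itv/= => /andP[t0 ts]; rewrite ger0_norm//.
  exact: le_lt_trans sr.
have in0s' t : t \in `]0, s[ -> t \in `[0, s].
  by rewrite !in_itv/= => /andP[/ltW-> /ltW->].
have b0 : (0 : K) \in `[0, s] by rewrite in_itv/= lexx ltW.
have bs : s \in `[0, s] by rewrite in_itv/= lexx ltW.
have dline t c : t \in `[0, s] -> c \in `[0, s] ->
    is_derive t 1 (fun t => g (x + c *: b + t *: a)) ('D_a g (x + t *: a + c *: b)).
  move=> t0s c0s; rewrite addrAC; apply: is_derive_line; apply: dg.
  by rewrite addrAC; apply: (rP _ _ _ _).1; exact: in0s.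
(* The second difference is [phi s - phi 0]. Writing [0 *: b] lets [dline] serve both terms, with
   [c = s] and [c = 0]. *)
pose phi t : K := g (x + s *: b + t *: a) - g (x + 0 *: b + t *: a).
have dphi t : t \in `[0, s] -> is_derive t 1 phi
   ('D_a g (x + t *: a + s *: b) - 'D_a g (x + t *: a + 0 *: b)).
  by move=> ts; apply: is_deriveB; exact: dline.
have [|t ts] := @MVT_segment _ phi _ 0 s (ltW s0) (fun t h => dphi t (in0s' _ h)).
  apply: derivable_within_continuous => t /dphi h; exact: ex_derive.
have dpsi c : c \in `[0, s] -> is_derive c 1 (fun c => 'D_a g (x + t *: a + c *: b))
   ('D_b ('D_a g) (x + t *: a + c *: b)).
  by move=> c0s; apply: is_derive_line; apply: ddg;
    apply: (rP _ _ _ _).1; exact: in0s.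
have [|c cs ->] := @MVT_segment _ _ _ 0 s (ltW s0) (fun t h => dpsi t (in0s' _ h)).
  apply: derivable_within_continuous => c /dpsi h; exact: ex_derive.
rewrite /phi !scale0r !addr0 subr0 => E.
have -> : g (x + s *: a + s *: b) - g (x + s *: a) - g (x + s *: b) + g x =
    'D_b ('D_a g) (x + t *: a + c *: b) * s ^+ 2.
  by rewrite expr2 mulrA -E [x + s *: b + _]addrAC opprB addrA [LHS]addrAC.
rewrite [_ * s ^+ 2]mulrC mulKf ?expf_neq0 ?gt_eqF//.
by apply: (rP _ _ _ _).2; exact: in0s.
Unshelve. all: by end_near. Qed.

Lemma derive_coord (K : realType) (V : normedModType K) (m : nat)
    (f : V -> 'cV[K]_m) (x v : V) (i : 'I_m) : derivable f x v ->
  'D_v (fun y => f y i 0) x = 'D_v f x i 0.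
Proof. by move=> df; rewrite derive_mx// mxE. Qed.

(* Schwarz: both mixed derivatives are the limit of the same second difference
   quotient. *)
Lemma derive_sym (K : realType) (V : normedModType K) (m : nat) (D : set V)
    (f : V -> 'cV[K]_m) (a b x : V) :
  open D -> D x -> smooth_on D f -> 'D_a ('D_b f) x = 'D_b ('D_a f) x.
Proof.
move=> oD Dx sf; apply/colP => i.
have df v y : D y -> derivable f y v.
  by move=> Dy; apply/diff_derivable; exact: (sf 1%N).1.
have ddf v w y : D y -> derivable ('D_v f) y w.
  by move=> Dy; apply/diff_derivable; exact: ((sf 2%N).2 v).1.
(* Coordinates commute with the derivative at points of [D]; equality on a neighbourhood is what
   allows differentiating once more. *)
have near_coord v y : D y ->
    \forall z \near y, 'D_v (fun y => f y i 0) z = 'D_v f z i 0.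
  move=> Dy; near=> z; apply: derive_coord; apply: df; near: z.
  exact: open_nbhs_nbhs.
have dd v w y : D y ->
    'D_w ('D_v (fun y => f y i 0)) y = 'D_w ('D_v f) y i 0.
  move=> Dy; rewrite (near_eq_derive w (near_coord v y Dy)).
  by apply: derive_coord; exact: ddf.
suff E : 'D_a ('D_b (fun y => f y i 0)) x = 'D_b ('D_a (fun y => f y i 0)) x.
  exact: etrans (esym (dd b a x Dx)) (etrans E (dd a b x Dx)).
have lim v w := @second_difference_cvg K V (fun y => f y i 0) D v w x oD Dx.
have {}lim v w : s ^- 2 * (f (x + s *: v + s *: w) i 0 - f (x + s *: v) i 0 -
    f (x + s *: w) i 0 + f x i 0) @[s --> 0^'+] -->
    'D_w ('D_v (fun y => f y i 0)) x.
  apply: lim => [y Dy|y Dy|].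
  - by have /derivable_mxP := df v y Dy.
  - apply: (near_eq_derivable (f := fun z => 'D_v f z i 0)).
      apply: filterS (near_coord v y Dy) => z; exact: esym.
    by have /derivable_mxP := ddf v w y Dy.
  - rewrite /prop_for /continuous_at (dd v w x Dx).
    have c : 'D_w ('D_v f) z i 0 @[z --> x] --> 'D_w ('D_v f) x i 0.
      apply: (@continuous_comp _ _ _ ('D_w ('D_v f)) (fun M : 'cV[K]_m => M i 0)).
        exact: ((sf 2%N).2 v).2.
      exact: coord_continuous.
    apply: (cvg_trans _ c); apply: near_eq_cvg; near=> z.
    by apply/esym/dd; near: z; exact: open_nbhs_nbhs.
(* Exchanging [a] and [b] only swaps the two middle terms of the second difference. *)
apply: (cvg_unique _ (lim b a)); first exact: norm_hausdorff.
rewrite (_ : (fun s => _) = (fun s : K => s ^- 2 *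
    (f (x + s *: a + s *: b) i 0 - f (x + s *: a) i 0 - f (x + s *: b) i 0 + f x i 0))); first exact: lim.
apply/funext => s; congr (_ * (_ + _)).
by rewrite [x + s *: b + _]addrAC [LHS]addrAC.
Unshelve. all: by end_near. Qed.

(** * Product rule for a Jacobian applied to a vector *)

Lemma differentiable_scale (K : realType) (V : normedModType K) (m : nat)
    (k : V -> K) (f : V -> 'cV[K]_m) (x : V) :
  differentiable k x -> differentiable f x ->
  differentiable (fun y => k y *: f y) x.
Proof.
move=> dk df.
have -> : (fun y => k y *: f y) =
    \sum_i (fun y => (k * (fun z => f z i 0)) y *: (delta_mx i 0 : 'cV[K]_m)).
  apply/funext => y; rewrite fct_sumE [in LHS](cV_expand (f y)) scaler_sumr.
  by apply: eq_bigr => i _; rewrite scalerA.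
apply: differentiable_sum => i; apply: differentiableZl; apply: differentiableM => //.
exact: (differentiable_comp df (differentiable_coord _ _ _)).
Qed.

Lemma derive_scale (K : realType) (V : normedModType K) (m : nat)
    (k : V -> K) (f : V -> 'cV[K]_m) (x v : V) :
  differentiable k x -> differentiable f x ->
  'D_v (fun y => k y *: f y) x = k x *: 'D_v f x + 'D_v k x *: f x.
Proof.
move=> dk df; apply/colP => i.
have fi : derivable (fun y => f y i 0) x v.
  exact: diff_derivable (differentiable_comp df (differentiable_coord _ _ _)).
rewrite derive_mx; last exact/diff_derivable/differentiable_scale.
rewrite !mxE (_ : (fun y => _) = k * (fun y => f y i 0)); last first.
  by apply/funext => y; rewrite mxE.
rewrite (deriveM (diff_derivable dk) fi).
rewrite (derive_coord i (diff_derivable df)).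
by congr (_ + _); rewrite -[LHS]mulrC.
Qed.

(** The source space [X] is general because two cases occur: the (t, x) plane for the flux, and the
    product space for the joint map (V, W) |-> [jac F V *m W]. *)
Lemma jac_mul_differentiable (K : realType) (X : normedModType K) (m : nat)
    (D : set 'cV[K]_m) (F : 'cV[K]_m -> 'cV[K]_m) (a b : X -> 'cV[K]_m) (x : X) :
  D (a x) -> smooth_on D F -> differentiable a x -> differentiable b x ->
  differentiable (fun q => jac F (a q) *m b q) x.
Proof.
move=> Dx sF da db.
have -> : (fun q => jac F (a q) *m b q) =
    \sum_j (fun q => b q j 0 *: 'D_(delta_mx j 0) F (a q)).
  by apply/funext => q; rewrite fct_sumE jac_mulE.
apply: differentiable_sum => j; apply: differentiable_scale.
  exact: (differentiable_comp db (differentiable_coord _ _ _)).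
exact: (differentiable_comp da (((sF 2%N).2 (delta_mx j 0)).1 _ Dx)).
Qed.

(** The second differential F''(x)[h, k] in coordinates: [jac F] is differentiated in the direction
    [h] and applied to [k]. *)
Definition hess (K : realType) (m : nat) (F : 'cV[K]_m -> 'cV[K]_m)
    (x h k : 'cV[K]_m) : 'cV[K]_m :=
  \sum_j k j 0 *: \sum_l h l 0 *: 'D_(delta_mx l 0) ('D_(delta_mx j 0) F) x.

Lemma hess_sym (K : realType) (m : nat) (D : set 'cV[K]_m)
    (F : 'cV[K]_m -> 'cV[K]_m) (x h k : 'cV[K]_m) :
  open D -> D x -> smooth_on D F -> hess F x h k = hess F x k h.
Proof.
move=> oD Dx sF; rewrite /hess.
under eq_bigr do rewrite scaler_sumr.
under [RHS]eq_bigr do rewrite scaler_sumr.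
rewrite exchange_big/=; apply: eq_bigr => l _; apply: eq_bigr => j _.
have E := derive_sym (delta_mx l 0) (delta_mx j 0) oD Dx sF.
rewrite !scalerA [in LHS]mulrC.
exact: (f_equal2 (fun (c : K) (w : 'cV[K]_m) => c *: w) (erefl _) E).
Qed.

Lemma derive_jac_mul (K : realType) (X : normedModType K) (m : nat)
    (D : set 'cV[K]_m) (F : 'cV[K]_m -> 'cV[K]_m) (a b : X -> 'cV[K]_m) (x v : X) :
  D (a x) -> smooth_on D F -> differentiable a x -> differentiable b x ->
  'D_v (fun q => jac F (a q) *m b q) x =
  hess F (a x) ('D_v a x) (b x) + jac F (a x) *m 'D_v b x.
Proof.
move=> Dx sF da db.
have dF j : differentiable ('D_(delta_mx j 0) F) (a x) by exact: ((sF 2%N).2 _).1.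
have dbj j : differentiable (fun q => b q j 0) x.
  exact: (differentiable_comp db (differentiable_coord _ _ _)).
have dFa j : differentiable (fun q => 'D_(delta_mx j 0) F (a q)) x.
  exact: (differentiable_comp da (dF j)).
have -> : (fun q => jac F (a q) *m b q) =
    \sum_j (fun q => b q j 0 *: 'D_(delta_mx j 0) F (a q)).
  by apply/funext => q; rewrite fct_sumE jac_mulE.
rewrite derive_sum; last first.
  by move=> j; apply: diff_derivable; apply: differentiable_scale.
rewrite jac_mulE /hess -big_split; apply: eq_bigr => j _ /=.
rewrite derive_scale// derive_coord; last exact: diff_derivable.
congr (_ *: _ + _).
by rewrite (derive_comp_jac v da (dF j)) jac_mulE.
Qed.

Lemma fst_differentiable (K : realType) (V W : normedModType K) (x : V * W) :
  differentiable (fst : V * W -> V) x.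
Proof. by apply: (@linear_differentiable _ _ _ fst) => y; exact: cvg_fst. Qed.

Lemma snd_differentiable (K : realType) (V W : normedModType K) (x : V * W) :
  differentiable (snd : V * W -> W) x.
Proof. by apply: (@linear_differentiable _ _ _ snd) => y; exact: cvg_snd. Qed.

Lemma derive_fst (K : realType) (V W : normedModType K) (x v : V * W) :
  'D_v (fst : V * W -> V) x = v.1.
Proof.
rewrite deriveE; last exact: fst_differentiable.
by rewrite (@diff_lin _ _ _ fst)// => y; exact: cvg_fst.
Qed.

Lemma derive_snd (K : realType) (V W : normedModType K) (x v : V * W) :
  'D_v (snd : V * W -> W) x = v.2.
Proof.
rewrite deriveE; last exact: snd_differentiable.
by rewrite (@diff_lin _ _ _ snd)// => y; exact: cvg_snd.
Qed.

(** * Kernels and left inverses *)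

(* By dimension, the column space of [J] is the whole kernel of [B]. *)
Lemma col_mx_inj (F : fieldType) (N n : nat) (B : 'M[F]_N) (Q : 'M[F]_(n, N))
    (J : 'M[F]_(N, n)) (V : 'cV[F]_N) :
  \rank (kermx B^T) = n -> B *m J = 0 -> Q *m J = 1%:M ->
  B *m V = 0 -> Q *m V = 0 -> V = 0.
Proof.
move=> rB BJ QJ BV QV.
have JB : (J^T <= kermx B^T)%MS.
  by apply/sub_kermxP; rewrite -trmx_mul BJ trmx0.
have Jfree : row_free J^T.
  by apply/row_freeP; exists Q^T; rewrite -trmx_mul QJ trmx1.
have : (kermx B^T <= J^T)%MS.
  (* [Jfree] unfolds to equality of the two ranks, which reverses the inclusion [JB]. *)
  by rewrite -(mxrank_leqif_sup JB) rB; exact: Jfree.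
have VB : (V^T <= kermx B^T)%MS.
  by apply/sub_kermxP; rewrite -trmx_mul BV trmx0.
move=> /(submx_trans VB)/submxP[w Vw].
have VE : V = J *m w^T by rewrite -[LHS]trmxK Vw trmx_mul trmxK.
by move: QV; rewrite VE mulmxA QJ mul1mx => ->; rewrite mulmx0.
Qed.

(** [pinvmx] is a right inverse of a row-free matrix, and injectivity of [L] on columns says that
    [L^T] is row-free; hence the two transpositions. *)
Lemma left_inverse_of_inj (F : fieldType) (m n : nat) (L : 'M[F]_(m, n)) :
  (forall V : 'cV[F]_n, L *m V = 0 -> V = 0) -> (pinvmx L^T)^T *m L = 1%:M.
Proof.
move=> inj; rewrite -[X in _ *m X](trmxK L) -trmx_mul mulmxVp ?trmx1//.
apply: inj_row_free => v vL; apply: trmx_inj; rewrite trmx0; apply: inj.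
by rewrite -[X in X *m _](trmxK L) -trmx_mul vL trmx0.
Qed.

(** * Expansions in the small parameter *)

(** Multiplied by [e], the scaled remainder becomes the quotient minus [f1 + e *: f2]. *)
Lemma expands_cvg (K : realType) (W : normedModType K) (f : K -> W)
    (f0 f1 f2 : W) : expands f f0 f1 f2 ->
  e^-1 *: (f e - f0) @[e --> 0^'+] --> f1.
Proof.
rewrite /expands => fe.
have e0 : e @[e --> (0 : K)^'+] --> (0 : K) by apply: cvg_within.
have h : e *: (e ^- 2 *: (f e - (f0 + e *: f1 + e ^+ 2 *: f2))) + (f1 + e *: f2)
    @[e --> 0^'+] --> 0 *: 0 + (f1 + 0 *: f2).
  apply: cvgD; first exact: cvgZ.
  by apply: cvgD; [exact: cvg_cst|apply: cvgZ => //; exact: cvg_cst].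
rewrite !scale0r add0r addr0 in h.
apply: (cvg_trans _ h); apply: near_eq_cvg; near=> e.
have e_neq0 : e != 0 by apply: lt0r_neq0; near: e; exact: nbhs_right_gt.
have -> : f e - (f0 + e *: f1 + e ^+ 2 *: f2) = f e - f0 - e *: (f1 + e *: f2).
  by rewrite scalerDr scalerA -expr2 -addrA opprD addrA.
rewrite scalerA (_ : e * e ^- 2 = e^-1); last by rewrite expr2 invfM mulrA divff// mul1r.
by rewrite scalerBr scalerA mulVf// scale1r subrK.
Unshelve. all: by end_near. Qed.

(** This is [cvg_diff_quotient] for the joint map (V, W) |-> [jac F V *m W] along the curve
    [(a e, w e)]. *)
Lemma jac_mul_quotient (K : realType) (m : nat) (D : set 'cV[K]_m)
    (F : 'cV[K]_m -> 'cV[K]_m) (a w : K -> 'cV[K]_m) (V0 W0 V1 W1 : 'cV[K]_m) :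
  D V0 -> smooth_on D F ->
  e^-1 *: (a e - V0) @[e --> 0^'+] --> V1 ->
  e^-1 *: (w e - W0) @[e --> 0^'+] --> W1 ->
  e^-1 *: (jac F (a e) *m w e - jac F V0 *m W0) @[e --> 0^'+] -->
    hess F V0 V1 W0 + jac F V0 *m W1.
Proof.
move=> DV sF aV wW.
have dfst := @fst_differentiable K 'cV[K]_m 'cV[K]_m (V0, W0).
have dsnd := @snd_differentiable K 'cV[K]_m 'cV[K]_m (V0, W0).
have aw : e^-1 *: ((a e, w e) - (V0, W0)) @[e --> 0^'+] --> (V1, W1).
  exact: (cvg_pair aV wW).
have := cvg_diff_quotient (jac_mul_differentiable (D := D) (a := fst) (b := snd)
  (x := (V0, W0)) DV sF dfst dsnd) aw.
rewrite (derive_jac_mul (V1, W1) (D := D) (a := fst) (b := snd)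
  (x := (V0, W0)) DV sF dfst dsnd).
by rewrite derive_fst derive_snd.
Qed.

(** * Openness of the domains *)

Lemma half_plane_open (K : realType) : open (@half_plane K).
Proof.
apply: (@open_comp _ _ (fst : K * K -> K) [set t | 0 < t]); last exact: open_gt.
by move=> q _; exact: cvg_fst.
Qed.

(** Full rank gives [Q] the right inverse [pinvmx Q], so a point [y] near [Q *m V] has the preimage
    [V + pinvmx Q *m (y - Q *m V)], which is close to [V]. *)
Lemma range_of_open (K : realType) (N n : nat) (Q : 'M[K]_(n, N))
    (Omega : set 'cV[K]_N) : \rank Q = n -> open Omega -> open (range_of Q Omega).
Proof.
move=> rQ oO; rewrite openE => _ [V OV <-].
have QQ : Q *m pinvmx Q = 1%:M by apply: mulmxVp; rewrite /row_free rQ.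
have c : {for Q *m V, continuous (fun y : 'cV[K]_n => V + pinvmx Q *m (y - Q *m V))}.
  apply: differentiable_continuous.
  have d : differentiable (fun y : 'cV[K]_n => y - Q *m V) (Q *m V).
    exact: differentiableB.
  exact: (differentiableD (differentiable_cst V _)
    (differentiable_comp d (mulmx_differentiable (pinvmx Q) _))).
rewrite /prop_for /continuous_at subrr mulmx0 addr0 in c.
apply: (@filterS _ (nbhs (Q *m V)) _ _ _ _ (c _ (open_nbhs_nbhs (conj oO OV)))) => y /= Oy.
exists (V + pinvmx Q *m (y - Q *m V)) => //.
by rewrite mulmxDr mulmxA QQ mul1mx addrC subrK.
Qed.

(** * Orders 0 and 1 of the expansion, and the effective system *)

Theorem theorem1 (K : realType) (N n : nat) (Omega : set 'cV[K]_N)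
    (F R : 'cV[K]_N -> 'cV[K]_N) (Q : 'M[K]_(n, N))
    (E : 'cV[K]_n -> 'cV[K]_N)
    (A := jac F) (B := jac R) (omega := range_of Q Omega)
    (Omega_open : open Omega)
    (Omega_convex : convex_set (Omega : set (convex_lmodType 'cV[K]_N)))
    (F_smooth : smooth_on Omega F)
    (R_smooth : smooth_on Omega R)
    (hyperbolic : forall V, Omega V -> real_eigenbasis (A V))
    (* Condition 1 *)
    (Q_rank : \rank Q = n)
    (n_lt_N : (n < N)%N)
    (QR0 : forall V, Omega V -> Q *m R V = 0)
    (* Condition 2 *)
    (E_smooth : smooth_on omega E)
    (E_Omega : forall v, omega v -> Omega (E v))
    (RE0 : forall v, omega v -> R (E v) = 0)
    (QE : forall v, omega v -> Q *m E v = v)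
    (* Condition 3 *)
    (QFE0 : forall v, omega v -> Q *m F (E v) = 0)
    (* Condition 4 *)
    (kerB : forall v, omega v -> ker_dim (B (E v)) = n)
    (kerB_imB : forall v, omega v -> ker_im_trivial (B (E v))) :
  exists M : 'cV[K]_n -> 'M[K]_n,
  forall (u : K * K -> 'cV[K]_n) (U1 U2 : K * K -> 'cV[K]_N)
         (U : K -> K * K -> 'cV[K]_N),
    (forall p, half_plane p -> omega (u p)) ->
    smooth_on (@half_plane K) u ->
    smooth_on (@half_plane K) U1 ->
    smooth_on (@half_plane K) U2 ->
    chapman_enskog F R Q u (E \o u) U1 U2 U ->
  forall p, half_plane p ->
    [/\ unique (fun V : 'cV[K]_N =>
                  B (E (u p)) *m V = - (A (E (u p)) *m dx (E \o u) p) /\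
                  Q *m V = 0) (U1 p),
        derivable (fun q => Q *m A (E (u q)) *m U1 q) p (0, 1),
        derivable (fun q => M (u q) *m dx u q) p (0, 1),
        dt u p = - dx (fun q => Q *m A (E (u q)) *m U1 q) p &
        - dx (fun q => Q *m A (E (u q)) *m U1 q) p =
          dx (fun q => M (u q) *m dx u q) p].
Proof.
pose J v := jac E v.
pose P v := (pinvmx (col_mx (B (E v)) Q)^T)^T.
have oomega : open omega by exact: range_of_open.
have dE v : omega v -> differentiable E v by exact: (E_smooth 1%N).1.
have dF V : Omega V -> differentiable F V by exact: (F_smooth 1%N).1.
have dR V : Omega V -> differentiable R V by exact: (R_smooth 1%N).1.
(* Differentiate [R (E v) = 0], which holds on a neighbourhood because [omega] is open; [QJ] treats
   [Q *m E v = v] likewise. *)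
have BJ v : omega v -> B (E v) *m J v = 0.
  move=> ov; apply/matrixP => i j.
  have : 'D_(delta_mx j 0) (R \o E) v = 0.
    rewrite (near_eq_derive _ (g := cst 0)) ?derive_cst//.
    by near=> w; apply: RE0; near: w; exact: open_nbhs_nbhs.
  rewrite (derive_comp_jac _ (dE v ov) (dR _ (E_Omega v ov))) (derive_jac _ (dE v ov)).
  by rewrite mulmxA -colE => /colP/(_ i); rewrite !mxE.
have QJ v : omega v -> Q *m J v = 1%:M.
  move=> ov; apply/matrixP => i j.
  have : 'D_(delta_mx j 0) (fun v => Q *m E v) v = delta_mx j 0.
    rewrite (near_eq_derive _ (g := id)) ?derive_id//.
    by near=> w; apply: QE; near: w; exact: open_nbhs_nbhs.
  rewrite (derive_mulmx _ _ (dE v ov)) (derive_jac _ (dE v ov)).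
  by rewrite mulmxA -colE => /colP/(_ i); rewrite !mxE eqxx andbT.
have inj v (V : 'cV[K]_N) : omega v -> B (E v) *m V = 0 -> Q *m V = 0 -> V = 0.
  by move=> ov; exact: (col_mx_inj (kerB v ov) (BJ v ov) (QJ v ov)).
have PK v : omega v -> P v *m col_mx (B (E v)) Q = 1%:M.
  move=> ov; apply: left_inverse_of_inj => V; rewrite mul_col_mx -col_mx0.
  by move=> /eq_col_mx[]; exact: inj.
(* By [PK], the solution of the stacked system is [U1 = - P *m col_mx (A *m J *m dx u) 0]; [M] is
   read off from [- Q *m A *m U1] and is fixed before [u] is introduced. *)
pose M v := Q *m A (E v) *m P v *m col_mx (A (E v) *m J v) 0.
exists M => u U1 U2 U uomega su sU1 sU2 ce p hp.
have du q : half_plane q -> differentiable u q by exact: (su 1%N).1.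
have dU1 q : half_plane q -> differentiable U1 q by exact: (sU1 1%N).1.
have dEu q : half_plane q -> differentiable (E \o u) q.
  by move=> hq; exact: (differentiable_comp (du q hq) (dE _ (uomega q hq))).
have Eu_Omega q : half_plane q -> Omega ((E \o u) q).
  by move=> hq; exact/E_Omega/uomega.
have near_half q : half_plane q -> \forall z \near q, half_plane z.
  by move=> hq; apply: open_nbhs_nbhs; split => //; exact: half_plane_open.
have U1_cvg q (hq : half_plane q) := expands_cvg (ce_expands ce hq).
have near_Omega q : half_plane q -> \forall e \near (0 : K)^'+, Omega (U e q).
  move=> hq; apply: (cvg_of_quotient (U1_cvg q hq)).
  by apply: open_nbhs_nbhs; split => //; exact: Eu_Omega.
(* The chain rule applies to [F \o U e] only for small [e], when [U e] is smooth and [U e q] lies in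
   [Omega]; then the expansions of [U e] and of [dx (U e)] are inserted. *)
have flux q : half_plane q ->
    e^-1 *: (dx (F \o U e) q - A (E (u q)) *m dx (E \o u) q) @[e --> 0^'+] -->
    hess F (E (u q)) (U1 q) (dx (E \o u) q) + A (E (u q)) *m dx U1 q.
  move=> hq.
  have h := jac_mul_quotient (Eu_Omega q hq) F_smooth (U1_cvg q hq)
    (expands_cvg (ce_expands_dx ce hq)).
  apply: (cvg_trans _ h); apply: near_eq_cvg; near=> e.
  congr (_ *: (_ - _)); apply/esym/derive_comp_jac.
    have sUe : smooth_on (@half_plane K) (U e) by near: e; exact: ce_smooth ce.
    exact: (sUe 1%N).1.
  by apply: dF; near: e; exact: near_Omega.
have e0 : e @[e --> (0 : K)^'+] --> (0 : K) by apply: cvg_within.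
(* The residual itself tends to 0. Its source term is a difference quotient of [R], since
   [R (E (u q)) = 0], so it tends to [B (E (u q)) *m U1 q]. *)
have order0 q : half_plane q ->
    B (E (u q)) *m U1 q = - (A (E (u q)) *m dx (E \o u) q).
  move=> hq.
  have res0 : residual F R e (U e) q @[e --> 0^'+] --> (0 : 'cV[K]_N).
    have h := ce_residual ce hq.
    apply: (@cvg_of_quotient _ _ _ _ 0).
    by apply: (cvg_trans _ h); apply: near_eq_cvg; near=> e; rewrite subr0.
  have resB : residual F R e (U e) q @[e --> 0^'+] -->
      0 *: dt (E \o u) q + A (E (u q)) *m dx (E \o u) q + B (E (u q)) *m U1 q.
    rewrite /residual; apply: cvgD; first apply: cvgD.
    - by apply: cvgZ => //; exact: cvg_of_quotient (expands_cvg (ce_expands_dt ce hq)).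
    - exact: cvg_of_quotient (flux q hq).
    - have dRq := dR _ (Eu_Omega q hq).
      have := cvg_diff_quotient dRq (U1_cvg q hq).
      rewrite (derive_jac _ dRq) /= RE0; last exact: uomega.
      by under eq_fun do rewrite subr0.
  have := cvg_unique (@norm_hausdorff _ _) res0 resB => /(_ (fmap_proper_filter _ _)).
  rewrite scale0r add0r => /eqP.
  by rewrite eq_sym addrC addr_eq0 => /eqP.
have solves q : half_plane q ->
    M (u q) *m dx u q = - (Q *m A (E (u q)) *m U1 q).
  move=> hq; have ouq := uomega q hq.
  have -> : U1 q = - (P (u q) *m col_mx (A (E (u q)) *m J (u q)) 0 *m dx u q).
    rewrite -[LHS]mul1mx -(PK (u q) ouq) -[LHS]mulmxA [in LHS]mul_col_mx.
    rewrite (order0 q hq) (ce_proj1 ce hq) -[in RHS]mulmxA mul_col_mx mul0mx.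
    rewrite -[in RHS]mulmxA -(derive_comp_jac _ (du q hq) (dE _ ouq)).
    by rewrite -[RHS]mulmxN opp_col_mx oppr0.
  by rewrite mulmxN opprK !mulmxA.
have flux_diff : differentiable (fun q => A (E (u q)) *m U1 q) p.
  exact: (jac_mul_differentiable (Eu_Omega p hp) F_smooth (dEu p hp) (dU1 p hp)).
have Qflux_diff : differentiable (fun q => Q *m A (E (u q)) *m U1 q) p.
  under eq_fun do rewrite -mulmxA.
  exact: (differentiable_comp flux_diff (mulmx_differentiable Q _)).
have near_solves : \forall q \near p,
    - (Q *m A (E (u q)) *m U1 q) = M (u q) *m dx u q.
  by near=> q; apply/esym/solves; near: q; exact: near_half.
(* The product rule puts [dx (E \o u) p] first in [hess], while [flux] puts [U1 p] first; [hess_sym]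
   reconciles them. *)
have dxQ : dx (fun q => Q *m A (E (u q)) *m U1 q) p =
    Q *m (hess F (E (u p)) (U1 p) (dx (E \o u) p) + A (E (u p)) *m dx U1 p).
  rewrite /dx; under eq_fun do rewrite -mulmxA.
  rewrite (derive_mulmx _ _ flux_diff); congr (_ *m _).
  rewrite (derive_jac_mul _ (Eu_Omega p hp) F_smooth (dEu p hp) (dU1 p hp)).
  by congr (_ + _); exact: (hess_sym _ _ Omega_open (Eu_Omega p hp) F_smooth).
(* The [x]-derivative of [Q *m F (E (u q)) = 0]. *)
have QAdxE : Q *m (A (E (u p)) *m dx (E \o u) p) = 0.
  rewrite -(derive_comp_jac _ (dEu p hp) (dF _ (Eu_Omega p hp))).
  rewrite -derive_mulmx; last exact: (differentiable_comp (dEu p hp) (dF _ (Eu_Omega p hp))).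
  rewrite (near_eq_derive _ (g := cst 0)) ?derive_cst//.
  by near=> q; apply/QFE0/uomega; near: q; exact: near_half.
have Qdt : Q *m dt (E \o u) p = dt u p.
  rewrite -(derive_mulmx _ _ (dEu p hp)); apply: near_eq_derive.
  by near=> q; apply/QE/uomega; near: q; exact: near_half.
have order1 : dt u p = - dx (fun q => Q *m A (E (u q)) *m U1 q) p.
  have res1 : Q *m (e^-1 *: residual F R e (U e) p) @[e --> 0^'+] --> Q *m 0.
    apply: (@cvg_comp _ _ _ _ (mulmx Q) _ _ _ (ce_residual ce hp)).
    exact: linear_cV_continuous.
  (* Subtracting [A (E (u p)) *m dx (E \o u) p] makes the flux converge after division by [e]. [Q]
     annihilates this term by [QAdxE], and the source by [QR0], so the limit is that of the
     projected residual. *)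
  have lim1 : Q *m (dt (U e) p + e^-1 *:
        (dx (F \o U e) p - A (E (u p)) *m dx (E \o u) p)) @[e --> 0^'+] -->
      Q *m (dt (E \o u) p + (hess F (E (u p)) (U1 p) (dx (E \o u) p) +
        A (E (u p)) *m dx U1 p)).
    apply: (@cvg_comp _ _ _ _ (mulmx Q)); last exact: linear_cV_continuous.
    apply: cvgD; last exact: flux.
    exact: cvg_of_quotient (expands_cvg (ce_expands_dt ce hp)).
  have {}lim1 : Q *m (e^-1 *: residual F R e (U e) p) @[e --> 0^'+] -->
      Q *m (dt (E \o u) p + (hess F (E (u p)) (U1 p) (dx (E \o u) p) +
        A (E (u p)) *m dx U1 p)).
    apply: (cvg_trans _ lim1); apply: near_eq_cvg; near=> e.
    have en0 : e != 0 by apply: lt0r_neq0; near: e; exact: nbhs_right_gt.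
    have OU : Omega (U e p) by near: e; exact: near_Omega.
    rewrite /residual !scalerDr [e^-1 *: (e *: _)]scalerA mulVf// scale1r.
    rewrite !mulmxDr -!scalemxAr.
    by rewrite mulmxN QAdxE oppr0 QR0// !scaler0 !addr0.
  have := cvg_unique (@norm_hausdorff _ _) res1 lim1 => /(_ (fmap_proper_filter _ _)).
  rewrite mulmx0 mulmxDr Qdt -dxQ => /esym/eqP.
  by rewrite addr_eq0 => /eqP.
split => //.
- split; first by split; [exact: order0|exact: (ce_proj1 ce hp)].
  move=> V [BV QV]; apply/eqP; rewrite -subr_eq0; apply/eqP.
  apply: (inj (u p)); first exact: uomega.
    by rewrite mulmxBr BV order0// subrr.
  by rewrite mulmxBr QV (ce_proj1 ce hp) subrr.
- exact: diff_derivable.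
(* Differentiability passes from [Q *m A *m U1] to [M (u q) *m dx u q] through their identity near
   [p], without differentiating the pseudo-inverse in [M]. *)
- apply: (near_eq_derivable near_solves).
  exact/derivableN/diff_derivable.
- apply: etrans (near_eq_derive _ near_solves); apply: esym.
  by apply: deriveN; exact: diff_derivable.
Unshelve. all: by end_near. Qed.
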